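(* Let $G=(E,V)$ be a locally finite (unoriented, weighted, loopless) graph, and let $\hat{\mathcal{A}}$ be a self-adjoint realization of the adjacency matrix $\mathcal{A}_G$. If the weight $E$ is unbounded (i.e. $\sup_{x,y\in V}E(x,y)=\infty$), then $\hat{\mathcal{A}}$ is unbounded from above and from below.
   Context: A graph $G=(E,V)$ consists of a countable set $V$ (vertices) and a symmetric function $E:V\times V\to[0,\infty)$ (weights), $E(x,y)=E(y,x)$, with no loops: $E(x,x)=0$ for all $x\in V$. Write $x\sim y$ if $E(x,y)\neq 0$. The degree of $x$ is $d_G(x):=|\{y\in V: E(x,y)\ne 0\}|$, and $G$ is locally finite if $d_G(x)<\infty$ for every $x\in V$. The Hilbert space is the complex space $\ell^2(V)$, and $\mathcal{C}_c(G)$ is the set of finitely supported functions $V\to\mathbb{C}$. The adjacency matrix is the symmetric operator $(\mathcal{A}_{G,\circ}f)(x):=\sum_{y\sim x}E(x,y)f(y)$ for $f\in\mathcal{C}_c(G)$; its closure is denoted $\mathcal{A}_G$. A self-adjoint realization of $\mathcal{A}_G$ is a self-adjoint operator on $\ell^2(V)$ extending $\mathcal{A}_G$. A self-adjoint operator $H$ is unbounded from above (resp. below) if $\sup\sigma(H)=+\infty$ (resp. $\inf\sigma(H)=-\infty$). *)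

(* Defs.v *)
From HB Require Import structures.
From mathcomp Require Import all_boot all_order all_algebra.
From mathcomp Require Import ring.
From mathcomp Require Import all_classical all_reals ereal esum.
From mathcomp.real_closed Require Import complex.

Set Implicit Arguments.
Unset Strict Implicit.
Unset Printing Implicit Defensive.

Import Order.TTheory GRing.Theory Num.Theory.

Local Open Scope classical_set_scope.
Local Open Scope ring_scope.
Local Open Scope complex_scope.

Record wgraph (R : realType) (V : countType) := WGraph {
  weight :> V -> V -> R;
  weight_ge0 : forall x y, 0 <= weight x y;
  weight_sym : forall x y, weight x y = weight y x;
  weight_loopless : forall x, weight x x = 0 }.

Section Graph.
Context {R : realType} {V : countType}.
Implicit Type G : wgraph R V.

Definition neighbors G (x : V) : set V := [set y | G x y != 0].

Definition locally_finite G := forall x, finite_set (neighbors G x).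

Definition unbounded_weight G :=
  ereal_sup [set (G p.1 p.2)%:E | p in [set: V * V]] = +oo%E.

End Graph.

Section SquareSummable.
Context {R : realType} {V : countType}.
Implicit Types f g : V -> R[i]^o.

Definition sqmod (z : R[i]) : R := complex.Re z ^+ 2 + complex.Im z ^+ 2.

Definition sqsum f : \bar R := (\esum_(x in [set: V]) (sqmod (f x))%:E)%R.

Definition square_summable : {pred V -> R[i]^o} :=
  [pred f | `[< (sqsum f < +oo)%E >]].

Lemma sqmod_ge0 z : 0 <= sqmod z.
Proof. by rewrite addr_ge0 ?sqr_ge0. Qed.

Lemma sqmodM a z : sqmod (a * z) = sqmod a * sqmod z.
Proof. by case: a z => [a b] [c d]; rewrite /sqmod /=; ring. Qed.

Lemma sqmodD_le u v : sqmod (u + v) <= 2 * sqmod u + 2 * sqmod v.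
Proof.
rewrite -subr_ge0 (_ : _ - _ = sqmod (u - v)) ?sqmod_ge0//.
by case: u v => [a b] [c d]; rewrite /sqmod /=; ring.
Qed.

Lemma esum_sqmodZ (k : R) f : 0 <= k -> (sqsum f < +oo)%E ->
  ((\esum_(x in [set: V]) (k * sqmod (f x))%:E)%R < +oo)%E.
Proof.
move=> k0 ff; apply: (@le_lt_trans _ _ (k%:E * sqsum f)%E); last first.
  by rewrite lte_mul_pinfty// lee_fin.
apply: ge_ereal_sup => _ [A AT <-].
under eq_fsbigr do rewrite EFinM.
rewrite -ge0_mule_fsumr => [|x]; last by rewrite lee_fin sqmod_ge0.
by rewrite lee_wpmul2l ?lee_fin//; apply: ereal_sup_ubound; exists A.
Qed.

Lemma square_summableP f :
  reflect (sqsum f < +oo)%E (f \in square_summable).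
Proof. exact: asboolP. Qed.

Lemma square_summable_submod : submod_closed square_summable.
Proof.
split=> [|a f g].
- apply/square_summableP.
  have -> : sqsum 0 = 0%E by apply: esum1 => x _; rewrite /sqmod /= expr0n addr0.
  exact: ltry.
- move=> /square_summableP ff /square_summableP gf; apply/square_summableP.
  have k0 : 0 <= 2 * sqmod a by rewrite mulr_ge0// sqmod_ge0.
  apply: (@le_lt_trans _ _ (\esum_(x in [set: V])
      ((2 * sqmod a * sqmod (f x))%:E + (2 * sqmod (g x))%:E))%E).
    apply: le_esum => x _; rewrite -EFinD lee_fin.
    by apply: le_trans (sqmodD_le _ _) _; rewrite /= sqmodM mulrA.
  rewrite esumD; [|by move=> x _; rewrite lee_fin mulr_ge0 ?sqmod_ge0..].
  by apply: lte_add_pinfty; exact: esum_sqmodZ.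
Qed.

HB.instance Definition _ :=
  GRing.isSubmodClosed.Build _ _ square_summable square_summable_submod.

End SquareSummable.

Record l2 (R : realType) (V : countType) := L2 {
  l2fun :> V -> R[i]^o;
  l2P : l2fun \in @square_summable R V }.

HB.instance Definition _ (R : realType) (V : countType) :=
  [isSub for @l2fun R V].
HB.instance Definition _ (R : realType) (V : countType) :=
  [Choice of l2 R V by <:].
HB.instance Definition _ (R : realType) (V : countType) :=
  [SubChoice_isSubLmodule of l2 R V by <:].

Section Hilbert.
Context {R : realType} {V : countType}.
Implicit Types f g : l2 R V.

(* Sum of an absolutely summable real (resp. complex) family, the real one
   being split into its positive and negative parts as in [esumB]. *)
Definition rsum (u : V -> R) : R :=
  fine (\esum_(x in [set: V]) (Num.max (u x) 0)%:E)%R -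
  fine (\esum_(x in [set: V]) (Num.max (- u x) 0)%:E)%R.

Definition csum (u : V -> R[i]) : R[i] :=
  rsum (fun x => complex.Re (u x)) +i* rsum (fun x => complex.Im (u x)).

Definition inner f g : R[i] := csum (fun x => f x * (g x)^*).

Definition l2norm f : R := Num.sqrt (fine (sqsum f)).

End Hilbert.

(* An unbounded operator is identified with its graph, a set of pairs (f, Tf). *)
Section Operators.
Context {R : realType} {V : countType}.
Local Notation H := (l2 R V).
Implicit Types (S T : set (H * H)) (f g h : H).

Definition is_operator T :=
  [/\ T (0, 0),
      forall (a : R[i]) f f' g g',
        T (f, g) -> T (f', g') -> T (a *: f + f', a *: g + g') &
      forall f g g', T (f, g) -> T (f, g') -> g = g'].

Definition dom T : set H := [set f | exists g, T (f, g)].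

Definition l2closure T : set (H * H) :=
  [set p | forall e : R, 0 < e ->
     exists2 q, T q & l2norm (p.1 - q.1) < e /\ l2norm (p.2 - q.2) < e].

Definition densely_defined T :=
  forall f (e : R), 0 < e -> exists2 g, dom T g & l2norm (f - g) < e.

Definition adjoint T : set (H * H) :=
  [set p | forall f g, T (f, g) -> inner g p.1 = inner f p.2].

Definition self_adjoint T :=
  [/\ is_operator T, densely_defined T & adjoint T = T].

(* z is in the resolvent set when T - z maps dom T bijectively onto l^2(V)
   with bounded inverse; g is in the range of T - z at f iff T f = g + z f. *)
Definition resolvent_set T : set R[i] :=
  [set z | (forall g, exists! f, T (f, g + z *: f)) /\
     exists c : R, forall f g, T (f, g + z *: f) -> l2norm f <= c * l2norm g].

Definition spectrum T : set R[i] := ~` resolvent_set T.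

(* The spectrum of a self-adjoint operator is real, so its supremum and infimum
   are taken over its real points. *)
Definition real_spectrum T : set R := [set t | spectrum T t%:C].

Definition unbounded_above T :=
  ereal_sup [set t%:E | t in real_spectrum T] = +oo%E.

Definition unbounded_below T :=
  ereal_inf [set t%:E | t in real_spectrum T] = -oo%E.

End Operators.

Section Adjacency.
Context {R : realType} {V : countType}.
Implicit Type G : wgraph R V.

Definition finitely_supported (f : V -> R[i]) := finite_set [set x | f x != 0].

(* The operator A_{G,o} with domain the finitely supported functions. When G is
   locally finite, the formula sends such functions to such functions. *)
Definition adjacency0 G : set (l2 R V * l2 R V) :=
  [set p : l2 R V * l2 R V | finitely_supported p.1 /\
     forall x, p.2 x = \sum_(y \in neighbors G x) (G x y)%:C * p.1 y].

Definition adjacency G := l2closure (adjacency0 G).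

Definition self_adjoint_realization G (T : set (l2 R V * l2 R V)) :=
  self_adjoint T /\ adjacency G `<=` T.

End Adjacency.

(* Main.v *)
Require Import Defs.
From mathcomp Require Import all_boot all_order all_algebra.
From mathcomp Require Import all_classical all_reals.
From mathcomp Require Import ring lra.
From mathcomp Require Import ereal esum.
From mathcomp.real_closed Require Import complex.

Set Implicit Arguments.
Unset Strict Implicit.
Unset Printing Implicit Defensive.

Import Order.TTheory GRing.Theory Num.Theory.

Local Open Scope classical_set_scope.
Local Open Scope ring_scope.
Local Open Scope complex_scope.

(** Assume that the spectrum of the realization [A] is bounded above. The idea
    is that the quadratic form of [A] is then bounded above by a multiple of
    the squared norm, which edges of large weight contradict: on
    [delta_x + delta_y], of squared norm 2, the form is twice the weight of the
    edge [xy].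

    The bound on the form is usually read off the spectral theorem. Here it
    comes from an elementary property of bounded symmetric operators: the
    supremum [m] of the numerical range of such an operator [B], if positive,
    lies in the spectrum of [B], because [m - B] is a positive operator whose
    form takes arbitrarily small values on unit vectors, and a bounded positive
    operator has [|(m - B) g|^2 <= K <(m - B) g, g>]. It is applied to
    [B = (A - t)^-1], for a [t] above the spectrum of [A]. If [m > 0] were the
    supremum of the numerical range of [B], then [t + 1/m] would be in the
    spectrum of [A], beyond [t]. Hence [B <= 0], and so [A - t <= 0] as a form
    ([inverse_form_le0], [form_le_of_resolvent]).

    For a spectrum bounded below the same argument applies to [- A], with the
    test vectors [- delta_x + delta_y] ([form_unbounded]).

    Only the real part of the inner product is used: it makes the Hilbert
    space a real inner product space, on which a symmetric operator is
    still symmetric. *)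

(** * Sums of absolutely summable real families *)

Section RealSums.
Context {R : realType} {V : countType}.
Implicit Types u v a b : V -> R.

Definition abs_summable u := (\esum_(x in [set: V]) `|u x|%:E < +oo)%E.

Definition possum u : R := fine (\esum_(x in [set: V]) (u x)%:E)%R.

Lemma le_abs_summable u v :
  (forall x, `|u x| <= `|v x|) -> abs_summable v -> abs_summable u.
Proof.
by move=> uv; apply: le_lt_trans; apply: le_esum => x _; rewrite lee_fin.
Qed.

Lemma abs_summableD u v :
  abs_summable u -> abs_summable v -> abs_summable (fun x => u x + v x).
Proof.
move=> su sv; apply: (@le_lt_trans _ _ (\esum_(x in [set: V])
    (`|u x|%:E + `|v x|%:E))%E).
  by apply: le_esum => x _; rewrite -EFinD lee_fin ler_normD.
rewrite esumD; [|by move=> x _; rewrite lee_fin..].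
exact: lte_add_pinfty.
Qed.

Lemma abs_summableZ (k : R) u :
  abs_summable u -> abs_summable (fun x => k * u x).
Proof.
move=> su; apply: (@le_lt_trans _ _
    (`|k|%:E * \esum_(x in [set: V]) `|u x|%:E)%E); last first.
  by rewrite lte_mul_pinfty// lee_fin.
apply: ge_ereal_sup => _ [A AT <-].
under eq_fsbigr do rewrite normrM EFinM.
rewrite -ge0_mule_fsumr => [|x]; last by rewrite lee_fin.
by rewrite lee_wpmul2l ?lee_fin//; apply: ereal_sup_ubound; exists A.
Qed.

Lemma possum_fin u : (forall x, 0 <= u x) -> abs_summable u ->
  (\esum_(x in [set: V]) (u x)%:E)%R \is a fin_num.
Proof.
move=> u0 su; rewrite ge0_fin_numE; last first.
  by apply: esum_ge0 => x _; rewrite lee_fin.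
by apply: le_lt_trans su; apply: le_esum => x _; rewrite lee_fin ler_norm.
Qed.

Lemma possumD u v :
  (forall x, 0 <= u x) -> (forall x, 0 <= v x) ->
  abs_summable u -> abs_summable v ->
  possum (fun x => u x + v x) = possum u + possum v.
Proof.
move=> u0 v0 su sv; rewrite /possum -fineD ?possum_fin// -esumD//;
  by move=> x _; rewrite lee_fin.
Qed.

Lemma possumZ (k : R) u : 0 < k -> (forall x, 0 <= u x) -> abs_summable u ->
  possum (fun x => k * u x) = k * possum u.
Proof.
have le_possumZ (l : R) (w : V -> R) :
    0 < l -> (forall x, 0 <= w x) -> abs_summable w ->
    possum (fun x => l * w x) <= l * possum w.
  move=> l0 w0 sw; have lw0 x : 0 <= l * w x by rewrite mulr_ge0 ?(ltW l0).
  rewrite -lee_fin EFinM /possum !fineK ?possum_fin//; last exact: abs_summableZ.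
  apply: ge_ereal_sup => _ [A AT <-].
  under eq_fsbigr do rewrite EFinM.
  rewrite -ge0_mule_fsumr => [|x]; last by rewrite lee_fin.
  by rewrite lee_wpmul2l ?lee_fin ?(ltW l0)//; apply: ereal_sup_ubound; exists A.
move=> k0 u0 su; apply/eqP; rewrite eq_le le_possumZ//=.
have ku0 x : 0 <= k * u x by rewrite mulr_ge0 ?(ltW k0).
rewrite -ler_pdivlMl//.
have := le_possumZ k^-1 (fun x => k * u x).
rewrite invr_gt0 => /(_ k0 ku0 (abs_summableZ _ su)).
by under [X in possum X]eq_fun do rewrite mulKf ?gt_eqF//.
Qed.

(** The positive part of a sum is not the sum of the positive parts, so [rsum]
    is not visibly additive. This lemma frees it from the particular splitting
    in its definition: any two splittings of [u] satisfy [a + u^- = b + u^+],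
    a relation between nonnegative families, whose sums are additive. *)
Lemma rsum_sub u a b :
  (forall x, 0 <= a x) -> (forall x, 0 <= b x) ->
  abs_summable a -> abs_summable b -> (forall x, u x = a x - b x) ->
  rsum u = possum a - possum b.
Proof.
move=> a0 b0 sa sb uab; rewrite /rsum -!/(possum _).
have su : abs_summable u.
  rewrite (_ : u = fun x => a x + -1 * b x); last first.
    by apply/funext => x; rewrite uab mulN1r.
  by apply: abs_summableD => //; apply: abs_summableZ.
have p0 (w : V -> R) x : 0 <= Num.max (w x) 0 by rewrite le_max lexx orbT.
have sp : abs_summable (fun x => Num.max (u x) 0).
  apply: le_abs_summable su => x; rewrite ger0_norm ?p0//.
  by rewrite ge_max ler_norm normr_ge0.
have sn : abs_summable (fun x => Num.max (- u x) 0).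
  apply: le_abs_summable su => x; rewrite ger0_norm ?(p0 (fun x => - u x))//.
  by rewrite ge_max ler_normr lexx orbT normr_ge0.
have pN0 := p0 (fun x => - u x).
apply/eqP; rewrite subr_eq addrAC eq_sym subr_eq -!possumD//.
apply/eqP; congr possum; apply/funext => x.
rewrite uab; case: (leP (a x - b x) 0) => h; rewrite ?opprB.
  by rewrite (max_l (_ : 0 <= _)); [ring|lra].
by rewrite (max_r (_ : _ <= 0)); [ring|lra].
Qed.

Lemma eq_rsum u v : (forall x, u x = v x) -> rsum u = rsum v.
Proof. by move=> /funext ->. Qed.

Lemma rsum_posneg u : abs_summable u -> exists a b, [/\
  (forall x, 0 <= a x) /\ (forall x, 0 <= b x), abs_summable a, abs_summable b &
  forall x, u x = a x - b x].
Proof.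
move=> su; exists (fun x => `|u x|), (fun x => `|u x| - u x); split.
- by split=> x; rewrite ?subr_ge0 ?ler_norm.
- by apply: le_abs_summable su => x; rewrite normr_id.
- apply: abs_summableD; first by apply: le_abs_summable su => x; rewrite normr_id.
  by apply: le_abs_summable su => x; rewrite normrN.
- by move=> x; ring.
Qed.

Lemma rsumD u v : abs_summable u -> abs_summable v ->
  rsum (fun x => u x + v x) = rsum u + rsum v.
Proof.
move=> /rsum_posneg[a [b [[a0 b0] sa sb uE]]].
move=> /rsum_posneg[c [d [[c0 d0] sc sd vE]]].
rewrite (rsum_sub a0 b0 sa sb uE) (rsum_sub c0 d0 sc sd vE).
rewrite (@rsum_sub _ (fun x => a x + c x) (fun x => b x + d x)).
- by rewrite !possumD//; ring.
- by move=> x; rewrite addr_ge0.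
- by move=> x; rewrite addr_ge0.
- exact: abs_summableD.
- exact: abs_summableD.
- by move=> x; rewrite uE vE; ring.
Qed.

Lemma rsumZ (k : R) u : abs_summable u -> rsum (fun x => k * u x) = k * rsum u.
Proof.
have rsumZ_gt0 (l : R) (w : V -> R) : 0 < l -> abs_summable w ->
    rsum (fun x => l * w x) = l * rsum w.
  move=> l0 /rsum_posneg[a [b [[a0 b0] sa sb wE]]].
  rewrite (rsum_sub a0 b0 sa sb wE).
  rewrite (@rsum_sub _ (fun x => l * a x) (fun x => l * b x)).
  - by rewrite !possumZ//; ring.
  - by move=> x; rewrite mulr_ge0 ?(ltW l0).
  - by move=> x; rewrite mulr_ge0 ?(ltW l0).
  - exact: abs_summableZ.
  - exact: abs_summableZ.
  - by move=> x; rewrite wE mulrBr.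
have rsumN (w : V -> R) : rsum (fun x => - w x) = - rsum w.
  rewrite /rsum opprB; congr (_ - fine _).
  by apply: eq_esum => x _; rewrite opprK.
move=> su; have [k0|k0|->] := ltgtP k 0; last 2 first.
- exact: rsumZ_gt0.
- rewrite (@eq_rsum _ (fun=> 0)); last by move=> x; rewrite mul0r.
  by rewrite mul0r; have := rsumN (fun=> 0); rewrite oppr0 => e; lra.
- rewrite (@eq_rsum _ (fun x => - (- k * u x))); last by move=> x; ring.
  by rewrite rsumN rsumZ_gt0 ?oppr_gt0// mulNr opprK.
Qed.

Lemma rsum_single u x : (forall z, z != x -> u z = 0) -> rsum u = u x.
Proof.
move=> ux.
have esum_single (w : V -> R) : (forall z, 0 <= w z) ->
    (forall z, z != x -> w z = 0) -> (\esum_(z in [set: V]) (w z)%:E = (w x)%:E)%E.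
  move=> w0 wx; rewrite -(@esum_set1 _ _ x (fun z => (w z)%:E)) ?lee_fin//.
  rewrite [RHS]esum_mkcond; apply: eq_esum => z _; case: ifPn => //.
  by rewrite notin_setE /= => /eqP /wx ->.
rewrite /rsum !esum_single /=.
- by case: (leP (u x) 0) => h; [rewrite max_l|rewrite max_r]; lra.
- by move=> z; rewrite le_max lexx orbT.
- by move=> z /ux ->; rewrite oppr0 maxxx.
- by move=> z; rewrite le_max lexx orbT.
- by move=> z /ux ->; rewrite maxxx.
Qed.

Lemma rsum_ge0 u : (forall x, 0 <= u x) -> rsum u = possum u.
Proof.
move=> u0; rewrite /rsum.
rewrite [X in _ - fine X]esum1 ?subr0; last first.
  by move=> x _; rewrite max_r// oppr_le0.
by under eq_esum do rewrite max_l//.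
Qed.

End RealSums.

(** * The real inner product underlying [l2] *)

Section RealInnerProduct.
Context {R : realType} {V : countType}.
Local Notation H := (l2 R V).
Implicit Types f g h : H.

Definition dot f g : R := complex.Re (inner f g).

Definition dot_at f g (x : V) : R :=
  complex.Re (f x) * complex.Re (g x) + complex.Im (f x) * complex.Im (g x).

Lemma dotE f g : dot f g = rsum (dot_at f g).
Proof.
apply: eq_rsum => x; rewrite /dot_at.
by case: (f x) (g x) => [a b] [c d] /=; ring.
Qed.

Lemma abs_summable_sqmod f : abs_summable (fun x => sqmod (f x)).
Proof.
have /square_summableP := l2P f; apply: le_lt_trans.
by apply: le_esum => x _; rewrite ger0_norm// sqmod_ge0.
Qed.

Lemma abs_summable_dot f g : abs_summable (dot_at f g).
Proof.
apply: le_abs_summable (abs_summableD (abs_summable_sqmod f) (abs_summable_sqmod g)).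
move=> x; rewrite [leRHS]ger0_norm; last by apply: addr_ge0; exact: sqmod_ge0.
rewrite /dot_at /sqmod; move: (f x) (g x) => [a b] [c d] /=.
have := (sqr_ge0 (a + c), sqr_ge0 (b + d), sqr_ge0 (a - c), sqr_ge0 (b - d)).
have := (sqr_ge0 a, sqr_ge0 b, sqr_ge0 c, sqr_ge0 d).
rewrite !(sqrrD, sqrrB, mulr2n) => -[[[? ?] ?] ?] [[[? ?] ?] ?].
by rewrite ler_norml; apply/andP; split; lra.
Qed.

Lemma dotC f g : dot f g = dot g f.
Proof. by rewrite !dotE; apply: eq_rsum => x; rewrite /dot_at; ring. Qed.

Lemma dotDl f g h : dot (f + g) h = dot f h + dot g h.
Proof.
rewrite !dotE -rsumD; try exact: abs_summable_dot.
apply: eq_rsum => x; rewrite /dot_at -[(f + g) x]/(f x + g x).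
by case: (f x) (g x) => [a b] [c d] /=; ring.
Qed.

Lemma dotZl (a : R) f g : dot (a%:C *: f) g = a * dot f g.
Proof.
rewrite !dotE -rsumZ; last exact: abs_summable_dot.
apply: eq_rsum => x; rewrite /dot_at -[(a%:C *: f) x]/(a%:C * f x).
by case: (f x) => [b c] /=; ring.
Qed.

Lemma dotNl f g : dot (- f) g = - dot f g.
Proof. by rewrite -scaleN1r -(rmorphN1 (real_complex R)) dotZl mulN1r. Qed.

Lemma dotDr f g h : dot f (g + h) = dot f g + dot f h.
Proof. by rewrite dotC dotDl !(dotC f). Qed.

Lemma dotZr (a : R) f g : dot f (a%:C *: g) = a * dot f g.
Proof. by rewrite dotC dotZl dotC. Qed.

Lemma dotNr f g : dot f (- g) = - dot f g.
Proof. by rewrite dotC dotNl dotC. Qed.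

Definition dot_linear := (dotDl, dotDr, dotZl, dotZr, dotNl, dotNr).

Lemma dotff f : dot f f = fine (sqsum f).
Proof.
rewrite dotE (@eq_rsum _ _ _ (fun x => sqmod (f x))); last first.
  by move=> x; rewrite /dot_at /sqmod !expr2.
by rewrite rsum_ge0// => x; exact: sqmod_ge0.
Qed.

Lemma dotff_ge0 f : 0 <= dot f f.
Proof. by rewrite dotff; apply/fine_ge0/esum_ge0 => x _; rewrite lee_fin sqmod_ge0. Qed.

Lemma l2norm_sqr f : l2norm f ^+ 2 = dot f f.
Proof. by rewrite sqr_sqrtr -dotff// dotff_ge0. Qed.

Lemma le_l2norm_dot (c : R) f g :
  l2norm f <= c * l2norm g -> dot f f <= c ^+ 2 * dot g g.
Proof.
move=> fg; rewrite -!l2norm_sqr -exprMn lerXn2r// nnegrE ?sqrtr_ge0//.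
by apply: le_trans fg; exact: sqrtr_ge0.
Qed.

Lemma dot_le_half f g : 2 * dot f g <= dot f f + dot g g.
Proof. by have := dotff_ge0 (f - g); rewrite !dot_linear (dotC g f); lra. Qed.

End RealInnerProduct.

(** * Symmetric relations and positivity *)

(** The arithmetic of [inverse_form_le0], where [fg], [gh] and so on stand for
    the inner products of [f = B g], of [g], of [h = (m - B) g] and, in [fhh], of
    [B h] with [h]. The form of [m - B] at [g - s h] is a quadratic polynomial
    in [s] whose leading coefficient is at most [(m + c + 1) * hh]; the step
    [s = 1 / (m + c + 1)] minimizes the polynomial with that larger coefficient,
    and its nonnegativity there is the conclusion. *)
Lemma quadratic_step (F : realFieldType) (m c fg gg fh gh fhh hh : F) :
  0 < m + c + 1 -> m * gh - fh = hh -> - fhh <= (c + 1) * hh ->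
  - (m + c + 1)^-1 * (- (m + c + 1)^-1 * fhh + fh) +
      (- (m + c + 1)^-1 * fh + fg) <=
    m * (- (m + c + 1)^-1 * (- (m + c + 1)^-1 * hh + gh) +
      (- (m + c + 1)^-1 * gh + gg)) ->
  hh <= (m + c + 1) * (m * gg - fg).
Proof.
set K := m + c + 1 => K_gt0 hE fhh_ge; set k := K^-1 => q.
have k_gt0 : 0 < k by rewrite invr_gt0.
have kK : k * K = 1 by rewrite mulVf// gt_eqF.
have q2 : k * k * (m * hh - fhh) <= k * hh.
  rewrite -mulrA ler_pM2l// -[leRHS]mul1r -kK -mulrA ler_pM2l// /K; lra.
have q1 : 2 * k * hh = 2 * k * (m * gh - fh) by rewrite hE.
have : k * hh <= m * gg - fg by lra.
by rewrite mulrC ler_pdivrMr// mulrC.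
Qed.

Section SymmetricRelation.
Context {R : realType} {V : countType}.
Local Notation H := (l2 R V).
Implicit Types (P : set (H * H)) (f g h : H).

Definition real_linear_relation P := forall (a : R) f g f' g',
  P (f, g) -> P (f', g') -> P (a%:C *: f + f', a%:C *: g + g').

Definition symmetric_relation P :=
  forall f g f' g', P (f, g) -> P (f', g') -> dot f g' = dot g f'.

(** [P] is the graph, written as pairs [(B g, g)], of a bounded symmetric
    operator [B] everywhere defined. The hypothesis on [s] says that [1/s - B]
    is bounded below, hence that no positive number is an approximate
    eigenvalue of [B]. If [<B g, g>] were positive somewhere, then the supremum
    [m] of the Rayleigh quotients would be such a number: [m - B] is a bounded
    positive operator, so [|(m - B) g|^2] is at most a multiple of
    [<(m - B) g, g>], and being bounded below [m - B] would have a form bounded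
    below by a positive multiple of the squared norm, which would allow [m]
    to be decreased. *)
Lemma inverse_form_le0 P (c : R) :
  real_linear_relation P -> symmetric_relation P ->
  (forall g, exists f, P (f, g)) -> 0 <= c ->
  (forall f g, P (f, g) -> dot f f <= c * dot g g) ->
  (forall s : R, 0 < s -> exists2 k : R, 0 <= k & forall f g, P (f, g) ->
     dot f f <= k * dot (g - s%:C *: f) (g - s%:C *: f)) ->
  forall f g, P (f, g) -> dot f g <= 0.
Proof.
move=> Plin Psym Psurj c0 Pc Pk f0 g0 Pfg0; rewrite leNgt; apply/negP => fg0.
have form_le f g : P (f, g) -> dot f g <= (c + 1) * dot g g.
  by move=> /Pc; have := dot_le_half f g; have := dotff_ge0 g; have := dotff_ge0 f; lra.
have form_ge f g : P (f, g) -> - dot f g <= (c + 1) * dot g g.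
  move=> /Pc; have := dot_le_half (- f) g; have := dotff_ge0 g; have := dotff_ge0 f.
  by rewrite !dot_linear; lra.
have gg0 f g : P (f, g) -> 0 < dot f g -> 0 < dot g g.
  move=> /form_le le_fg lt0; rewrite lt_neqAle dotff_ge0 andbT.
  by apply/eqP => e; move: le_fg; rewrite -e mulr0 leNgt lt0.
pose E := [set r | exists f g, [/\ P (f, g), 0 < dot g g & r = dot f g / dot g g]].
have Ef0 : E (dot f0 g0 / dot g0 g0) by exists f0, g0; split=> //; exact: (gg0 f0).
have ubE : ubound E (c + 1).
  by move=> _ [f [g [Pfg g0' ->]]]; rewrite ler_pdivrMr//; exact: form_le.
pose m := sup E.
have m_gt0 : 0 < m.
  apply: lt_le_trans (ub_le_sup _ Ef0); last by exists (c + 1).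
  by rewrite divr_gt0//; exact: (gg0 f0).
have form_le_m f g : P (f, g) -> dot f g <= m * dot g g.
  move=> Pfg; have [fg_le0|fg_gt0] := leP (dot f g) 0.
    by apply: le_trans fg_le0 _; rewrite mulr_ge0 ?dotff_ge0// ltW.
  have gp := gg0 _ _ Pfg fg_gt0.
  rewrite -ler_pdivrMr//; apply: ub_le_sup; first by exists (c + 1).
  by exists f, g.
pose K := m + c + 1; have K_gt0 : 0 < K by rewrite /K; lra.
(* The form of m - B is nonnegative at g - h / K, where h = (m - B) g. *)
have residual_le f g : P (f, g) ->
    dot (m%:C *: g - f) (m%:C *: g - f) <= K * (m * dot g g - dot f g).
  move=> Pfg; move hdef: (_ - f) => h; have [fh Ph] := Psurj h.
  have := form_le_m _ _ (Plin (- K^-1) _ _ _ _ Ph Pfg).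
  rewrite !dot_linear (dotC h g).
  have -> : dot fh g = dot f h by rewrite (Psym _ _ _ _ Ph Pfg) dotC.
  apply: (@quadratic_step _ m c); [lra| |exact: form_ge Ph].
  by rewrite -{3}hdef !dot_linear.
have mV_gt0 : 0 < m^-1 by rewrite invr_gt0.
have [k k0 Pkm] := Pk _ mV_gt0.
(* From g - m^-1 B g = m^-1 h and m g = h + B g, with h = (m - B) g. *)
have [L L_gt0 below] : exists2 L, 0 < L & forall f g, P (f, g) ->
    dot g g <= L * dot (m%:C *: g - f) (m%:C *: g - f).
  exists ((2 + 2 * k / m ^+ 2) / m ^+ 2).
    apply: divr_gt0; last by rewrite exprn_gt0.
    by apply: ltr_pwDl => //; rewrite divr_ge0 ?mulr_ge0 ?exprn_ge0// ltW.
  move=> f g Pfg; move hdef: (_ - f) => h.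
  have e : g - (m^-1)%:C *: f = (m^-1)%:C *: h.
    rewrite -hdef scalerBr scalerA -rmorphM mulVf ?gt_eqF// rmorph1 scale1r//.
  have := Pkm _ _ Pfg; rewrite e !dot_linear => ff_le.
  have e' : m%:C *: g = h + f by rewrite -hdef subrK.
  have := dot_le_half h f.
  have : m * (m * dot g g) = dot (h + f) (h + f) by rewrite -e' !dot_linear.
  rewrite !dot_linear (dotC f h) => gE half.
  rewrite mulrAC ler_pdivlMr ?exprn_gt0//.
  have -> : (2 + 2 * k / m ^+ 2) * dot h h =
      2 * dot h h + 2 * (k * (m^-1 * (m^-1 * dot h h))).
    by field; rewrite gt_eqF.
  by rewrite mulrC expr2 -mulrA; lra.
have : m <= m - (K * L)^-1.
  apply: ge_sup; first by exists (dot f0 g0 / dot g0 g0).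
  move=> _ [f [g [Pfg gp ->]]]; rewrite ler_pdivrMr// mulrBl.
  have le1 := below _ _ Pfg; have le2 := residual_le _ _ Pfg.
  have : dot g g <= K * L * (m * dot g g - dot f g).
    apply: le_trans le1 _; rewrite (mulrC K) -mulrA.
    exact: ler_wpM2l (ltW L_gt0) _ _ le2.
  rewrite -ler_pdivrMl ?mulr_gt0//; lra.
by apply/negP; rewrite -ltNge ltrBlDr ltrDl invr_gt0 mulr_gt0.
Qed.

End SymmetricRelation.

(** * The spectrum bounds the quadratic form *)

Section NumericalRange.
Context {R : realType} {V : countType}.
Local Notation H := (l2 R V).
Implicit Types (T : set (H * H)) (f g h : H).

Lemma operator_real_linear T : is_operator T -> real_linear_relation T.
Proof. by case=> _ Tlin _ a f g f' g'; exact: Tlin. Qed.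

Lemma self_adjoint_symmetric T : self_adjoint T -> symmetric_relation T.
Proof.
move=> [_ _ TE] f g f' g' Tfg Tf'g'.
have : adjoint T (f', g') by rewrite TE.
by move=> /(_ f g Tfg) /= e; rewrite /dot e.
Qed.

(** With [B = (T - t)^-1], the operator [1/s - B] is, up to the factor [1/s] and
    the composition with [T - t], the operator [T - (t + s)]; so resolvent
    points above [t] give the lower bounds that [inverse_form_le0] asks for. *)
Lemma form_le_of_resolvent T (t : R) :
  real_linear_relation T -> symmetric_relation T ->
  (forall s, t <= s -> resolvent_set T s%:C) ->
  forall f g, T (f, g) -> dot g f <= t * dot f f.
Proof.
move=> Tlin Tsym Tres f g Tfg.
pose P := [set p : H * H | T (p.1, p.2 + t%:C *: p.1)].
have [surj_t [c0 c0E]] := Tres t (lexx t).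
have : dot f (g - t%:C *: f) <= 0.
  apply: (@inverse_form_le0 _ _ P (c0 ^+ 2)); rewrite ?sqr_ge0//.
  - move=> a f1 g1 f2 g2; rewrite /P /= => T1 T2.
    rewrite [X in T (_, X)](_ : _ = a%:C *: (g1 + t%:C *: f1) + (g2 + t%:C *: f2)).
      exact: Tlin.
    by rewrite !scalerDr !scalerA (mulrC t%:C) addrACA.
  - move=> f1 g1 f2 g2; rewrite /P /= => T1 T2.
    by have := Tsym _ _ _ _ T1 T2; rewrite !dot_linear; lra.
  - by move=> h; have [f1 [? _]] := surj_t h; exists f1.
  - by move=> f1 g1 /c0E; exact: le_l2norm_dot.
  - move=> s s0; have [|_ [c cE]] := Tres (t + s); first by rewrite lerDl ltW.
    exists (c ^+ 2) => [|f1 g1 P1]; first exact: sqr_ge0.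
    apply/le_l2norm_dot/cE; move: P1; rewrite /P /=.
    by rewrite rmorphD scalerDl addrACA addNr addr0.
  - by rewrite /P /= subrK.
by rewrite !dot_linear dotC; lra.
Qed.

Definition opposite T : set (H * H) := [set p | T (p.1, - p.2)].

Lemma opposite_real_linear T :
  real_linear_relation T -> real_linear_relation (opposite T).
Proof.
move=> Tlin a f g f' g'; rewrite /opposite /= => T1 T2.
by rewrite opprD -scalerN; exact: Tlin.
Qed.

Lemma opposite_symmetric T :
  symmetric_relation T -> symmetric_relation (opposite T).
Proof.
move=> Tsym f g f' g' T1 T2; have := Tsym _ _ _ _ T1 T2.
by rewrite /= !dot_linear => /oppr_inj.
Qed.

Lemma l2normN g : l2norm (- g) = l2norm g.
Proof. by rewrite /l2norm -!dotff !dot_linear opprK. Qed.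

Lemma opposite_resolvent T (t : R) :
  resolvent_set T (- t)%:C -> resolvent_set (opposite T) t%:C.
Proof.
have oppE f g : opposite T (f, g + t%:C *: f) = T (f, - g + (- t)%:C *: f).
  by rewrite /opposite /= opprD rmorphN scaleNr.
move=> [surj [c cE]]; split=> [g|].
  have [f [Tf funiq]] := surj (- g); exists f.
  by split; [rewrite oppE|move=> f'; rewrite oppE; exact: funiq].
by exists c => f g; rewrite oppE => /cE; rewrite l2normN.
Qed.

Lemma bounded_above_resolvent T : ~ unbounded_above T ->
  exists M : R, forall s, M < s -> resolvent_set T s%:C.
Proof.
rewrite /unbounded_above.
set S := ereal_sup _ => /eqP; rewrite -ltey => S_fin.
have [M SM] : exists M : R, (S <= M%:E)%E.
  by case: S S_fin => [r||]// _; [exists r|exists 0; rewrite leNye].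
exists M => s Ms; apply: contrapT => ns; move: Ms; apply/negP; rewrite -leNgt.
rewrite -lee_fin; apply: le_trans SM; apply: ereal_sup_ubound.
by exists s.
Qed.

Lemma bounded_below_resolvent T : ~ unbounded_below T ->
  exists M : R, forall s, s < M -> resolvent_set T s%:C.
Proof.
rewrite /unbounded_below.
set S := ereal_inf _ => /eqP; rewrite -ltNye => S_fin.
have [M SM] : exists M : R, (M%:E <= S)%E.
  by case: S S_fin => [r||]// _; [exists r|exists 0; rewrite leey].
exists M => s Ms; apply: contrapT => ns; move: Ms; apply/negP; rewrite -leNgt.
rewrite -lee_fin; apply: le_trans SM _; apply: ereal_inf_lbound.
by exists s.
Qed.

Lemma self_adjoint_form_bounded_above T : self_adjoint T ->
  ~ unbounded_above T ->
  exists M : R, forall f g, T (f, g) -> dot g f <= M * dot f f.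
Proof.
move=> saT /bounded_above_resolvent[M TM]; exists (M + 1).
have [opT _ _] := saT; apply: form_le_of_resolvent => [||s Ms].
- exact: operator_real_linear.
- exact: self_adjoint_symmetric.
- by apply: TM; lra.
Qed.

Lemma self_adjoint_form_bounded_below T : self_adjoint T ->
  ~ unbounded_below T ->
  exists M : R, forall f g, T (f, g) -> - dot g f <= M * dot f f.
Proof.
move=> saT /bounded_below_resolvent[M TM]; exists (- M + 1) => f g Tfg.
have [opT _ _] := saT.
rewrite -dotNl; apply: (@form_le_of_resolvent (opposite T)) => [||s Ms|].
- exact: (opposite_real_linear (operator_real_linear opT)).
- exact: (opposite_symmetric (self_adjoint_symmetric saT)).
- by apply/opposite_resolvent/TM; lra.
- by rewrite /opposite /= opprK.
Qed.

End NumericalRange.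

(** * Test vectors supported on an edge *)

Section TestVectors.
Context {R : realType} {V : countType}.
Local Notation H := (l2 R V).
Context (G : wgraph R V).

Lemma finitely_supported_square_summable (f : V -> R[i]^o) :
  finitely_supported f -> f \in @square_summable R V.
Proof.
move=> ff; apply/square_summableP.
rewrite /sqsum (_ : \esum_(_ in _) _ =
    \esum_(x in [set x | f x != 0%R]) (sqmod (f x))%:E)%E; last first.
  rewrite [RHS]esum_mkcond; apply: eq_esum => x _; case: ifPn => //.
  rewrite notin_setE /= => /negP; rewrite negbK => /eqP ->.
  by rewrite /sqmod /= expr0n addr0.
rewrite esum_fset//; last by move=> x _; rewrite lee_fin sqmod_ge0.
by rewrite ltey_eq fsumEFin.
Qed.

Lemma delta_finitely_supported (x : V) :
  finitely_supported (fun z => (z == x)%:R : R[i]).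
Proof.
apply: (@sub_finite_set _ _ [set x]); last exact: finite_set1.
by move=> z /=; have [->|]// := eqVneq z x; rewrite eqxx.
Qed.

Definition delta (x : V) : H :=
  L2 (finitely_supported_square_summable (delta_finitely_supported x)).

Context (Gfin : locally_finite G).

Lemma column_finitely_supported (x : V) :
  finitely_supported (fun z => (G z x)%:C).
Proof.
apply: sub_finite_set (Gfin x) => z /=; rewrite /neighbors /= weight_sym.
by apply: contra => /eqP ->.
Qed.

Definition column (x : V) : H :=
  L2 (finitely_supported_square_summable (column_finitely_supported x)).

Lemma adjacency0_delta (x : V) : adjacency0 G (delta x, column x).
Proof.
split=> [|z] /=; first exact: delta_finitely_supported.
have [zx|zx] := pselect (neighbors G z x).
  rewrite -(@fsbig_widen _ _ _ _ [set x]) => [|y ->//|y /= [_ /eqP/negPf yx]].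
    by rewrite fsbig_set1 eqxx mulr1.
  by rewrite yx mulr0.
rewrite fsbig1 => [|y zy]; first by move: zx => /negP; rewrite negbK => /eqP ->.
have [yx|_] := eqVneq y x; last by rewrite mulr0.
by move: zy; rewrite yx.
Qed.

Lemma l2norm0 : l2norm (0 : H) = 0.
Proof.
by apply/eqP; rewrite -sqrf_eq0 l2norm_sqr -{1}(subrr 0) dotDl dotNl subrr.
Qed.

Lemma sub_l2closure (T : set (H * H)) : T `<=` l2closure T.
Proof.
by move=> p Tp e e0; exists p => //; rewrite !subrr l2norm0.
Qed.

Lemma dot_delta (f : H) (x : V) : dot f (delta x) = complex.Re (f x).
Proof.
rewrite dotE (rsum_single (x := x)) /dot_at /= ?eqxx /= => [|z /negPf ->].
  by rewrite mulr1 mulr0 addr0.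
by rewrite !mulr0 addr0.
Qed.

Lemma realization_column A x : self_adjoint_realization G A ->
  A (delta x, column x).
Proof. by move=> [_ subA]; apply/subA/sub_l2closure/adjacency0_delta. Qed.

Lemma dot_column_delta x y : dot (column x) (delta y) = G y x.
Proof. by rewrite dot_delta. Qed.

Lemma dot_delta_delta x y : dot (delta x) (delta y) = (y == x)%:R.
Proof. by rewrite dot_delta /=; case: (y == x). Qed.

Lemma heavy_edge (M : R) : unbounded_weight G -> exists x y, x != y /\ M < G x y.
Proof.
move=> Goo; have : ((Num.max M 0)%:E < +oo :> \bar R)%E by rewrite ltry.
rewrite -Goo => /ereal_sup_gt[_ [[x y] _ <-]]; rewrite lte_fin gt_max /=.
move=> /andP[MG G0]; exists x, y; split=> //; apply/eqP => xy.
by move: G0; rewrite xy weight_loopless ltxx.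
Qed.

(** The form of the adjacency matrix at [s delta_x + delta_y], where [s] is a
    sign, is twice [s] times the weight of the edge: the diagonal terms vanish
    because there are no loops. The squared norm of this vector is 2, whatever
    the edge. *)
Lemma form_unbounded A (s M : R) : s * s = 1 ->
  self_adjoint_realization G A -> unbounded_weight G ->
  exists f g, A (f, g) /\ M * dot f f < s * dot g f.
Proof.
move=> ss saA /(heavy_edge M)[x [y [xy MG]]]; have [[opA _ _] _] := saA.
exists (s%:C *: delta x + delta y), (s%:C *: column x + column y).
split; first by apply: operator_real_linear => //; exact: realization_column.
rewrite !dot_linear !dot_column_delta !dot_delta_delta !weight_loopless !eqxx.
rewrite (eq_sym y) (negPf xy) (weight_sym G y) ?mulr0n ?mulr1n.
have -> : M * (s * (s * 1 + 0) + (s * 0 + 1)) = M * (s * s) + M by ring.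
have -> : s * (s * (s * 0 + G x y) + (s * G x y + 0)) = 2 * (s * s) * G x y.
  by ring.
by rewrite ss; lra.
Qed.

End TestVectors.

Theorem proposition1p2 (R : realType) (V : countType) (G : wgraph R V)
    (A : set (l2 R V * l2 R V)) :
  locally_finite G ->
  self_adjoint_realization G A ->
  unbounded_weight G ->
  unbounded_above A /\ unbounded_below A.
Proof.
move=> Gfin saA Goo; have [sa _] := saA; split; apply: contrapT.
- move=> /(self_adjoint_form_bounded_above sa)[M AM].
  have [f [g [Afg]]] := form_unbounded Gfin M (mulr1 1) saA Goo.
  by rewrite mul1r ltNge AM.
- move=> /(self_adjoint_form_bounded_below sa)[M AM].
  have mN1N1 : -1 * -1 = 1 :> R by rewrite mulrNN mulr1.
  have [f [g [Afg]]] := form_unbounded Gfin M mN1N1 saA Goo.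
  by rewrite mulN1r ltNge AM.
Qed.
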